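(* Consider a deterministic horizon $n\in\mathbb{N}$. For any valuation profile distribution, the known-horizon sequential pricing problem can be formulated as maximizing a monotone submodular set function subject to a matroid feasibility constraint.
   Context: $I$ is a finite set of agents (buyers). The valuation profile $V=(V_i)_{i\in I}$ is a random vector in $\mathbb{R}_{\ge0}^I$ with an arbitrary (possibly correlated) known joint distribution. Each agent $i$ has a finite set $M_i\subset\mathbb{R}_{\ge0}$ of candidate prices. A call is a pair $e=(i_e,r_e)$ with $i_e\in I$, $r_e\in M_{i_e}$; $\mathcal{C}$ is the set of all calls. A call $e$ is accepted under a valuation realization $\mathbf v$ iff $\mathbf v_{i_e}\ge r_e$. A plan is a finite sequence of calls $\pi=(e_1,\dots,e_m)$, $e_t=(i_t,r_t)$; it is feasible if each agent appears in at most one of its calls. At most the first $\min(m,n)$ calls are attempted, and execution stops at the first acceptance, so for horizon $n$ $$\mathrm{Rev}_n(\pi;\mathbf v)=\sum_{t=1}^{\min(m,n)} r_t\,\mathbf 1\{\mathbf v_{i_t}\ge r_t\}\prod_{s<t}\mathbf 1\{\mathbf v_{i_s}<r_s\},\qquad \mathrm{Rev}_n(\pi)=\mathbb{E}_V[\mathrm{Rev}_n(\pi;V)].$$ The known-horizon sequential pricing problem is to maximize $\mathrm{Rev}_n(\pi)$ over all feasible plans $\pi$, where $n$ is known in advance. *)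

(* Defs.v *)
From HB Require Import structures.
From mathcomp Require Import all_boot all_order all_algebra finmap.
From mathcomp Require Import all_classical all_reals all_analysis.
Set Implicit Arguments.
Unset Strict Implicit.
Unset Printing Implicit Defensive.
Import Order.TTheory GRing.Theory Num.Theory.
Local Open Scope ring_scope.

Section SetFunctions.
Variables (R : realType) (E : finType).
Implicit Types (indep : {set {set E}}) (f : {set E} -> R) (A B : {set E}).

Definition is_matroid indep : Prop :=
  [/\ finset.set0 \in indep,
      forall A B, A \subset B -> B \in indep -> A \in indep &
      forall A B, A \in indep -> B \in indep -> (#|A| < #|B|)%N ->
        exists2 e, e \in B :\: A & e |: A \in indep].

Definition monotone_setfun f : Prop := forall A B, A \subset B -> f A <= f B.

Definition submodular f : Prop :=
  forall A B, f (A :|: B) + f (A :&: B) <= f A + f B.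

Definition optimal_set indep f A : Prop :=
  A \in indep /\ forall B, B \in indep -> f B <= f A.

End SetFunctions.

Section Pricing.
Variables (R : realType) (I : finType) (M : I -> {fset R}).

(* The set of all calls: pairs of an agent i and a price in M i. *)
Definition call : finType := {i : I & M i}.

Definition agent (e : call) : I := tag e.
Definition price (e : call) : R := fsval (tagged e).

Definition accepted (v : I -> R) (e : call) : bool := price e <= v (agent e).

Definition plan := seq call.

Definition feasible (pi : plan) : bool := uniq (map agent pi).

(* Calls are numbered from 0, so the attempted ones are those with index
   below min (size pi) n. *)
Definition rev_at (n : nat) (pi : plan) (v : I -> R) : R :=
  let e := tnth (in_tuple pi) in
  \sum_(t < size pi | (t < n)%N)
    price (e t) * (accepted v (e t))%:R *
    \prod_(s < size pi | (s < t)%N) (~~ accepted v (e s))%:R.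

Definition attempted (n : nat) (pi : plan) : {set call} :=
  finset.finset (mem (take n pi)).

Section Expected.
Variables (d : measure_display) (T : measurableType d) (P : probability T R).
Variables (V : I -> {RV P >-> R}) (n : nat).

Definition expected_rev (pi : plan) : \bar R :=
  ('E_P[fun w : T => rev_at n pi (fun i => V i w)])%E.

Definition optimal_plan (pi : plan) : Prop :=
  feasible pi /\ forall pi', feasible pi' -> (expected_rev pi' <= expected_rev pi)%E.

(* When the pricing problem "can be formulated" as maximizing f over indep:
   the feasible solutions of the two problems correspond via the set of
   attempted calls (a set of calls does not record their order, so its value is
   that of its best ordering), and both maxima are attained and equal. *)
Definition formulated_as (indep : {set {set call}}) (f : {set call} -> R) :
    Prop :=
  [/\ forall pi, feasible pi ->
        attempted n pi \in indep /\ (expected_rev pi <= (f (attempted n pi))%:E)%E,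
      forall S, S \in indep ->
        exists pi, [/\ feasible pi, (size pi <= n)%N, attempted n pi = S &
                       expected_rev pi = (f S)%:E] &
      exists pi S, [/\ optimal_plan pi, optimal_set indep f S,
                       attempted n pi = S & expected_rev pi = (f S)%:E]].

End Expected.
End Pricing.

(* Main.v *)
Require Import Defs.
From HB Require Import structures.
From mathcomp Require Import all_boot all_order all_algebra finmap.
From mathcomp Require Import all_classical all_reals all_analysis.
Set Implicit Arguments.
Unset Strict Implicit.
Unset Printing Implicit Defensive.
Import Order.TTheory GRing.Theory Num.Theory.
Local Open Scope ring_scope.

(** Fix a realization of the valuations and let the payoff of a call be its
    price if it is accepted and 0 otherwise.  A plan earns the price of its
    first accepted attempted call.  This is at most the largest payoff among
    the attempted calls, with equality when the calls are made in order of
    decreasing price, for then the first accepted call is a most expensive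
    accepted one.  Hence the best ordering of a set [S] of at most [n] calls
    does not depend on the realization, and [S] is worth the expectation of
    the largest payoff in [S], whatever the correlation between the agents.

    The maximum of nonnegative weights over a set is monotone and submodular
    in the set, and taking expectations preserves both properties
    ([max_weight_mono], [max_weight_submod]).  The sets that a plan can attempt
    are those of at most [n] calls to pairwise distinct agents; they are the
    independent sets of a truncated partition matroid
    ([matroid_distinct_labels]).  The two inequalities between plans and sets
    ([rev_at_le_best], [sorted_rev_at]) then match the two maximization
    problems. *)

(** * The truncated partition matroid *)

Definition distinct_labels (E I : finType) (h : E -> I) (n : nat) :
    {set {set E}} :=
  finset.finset (fun A : {set E} =>
    (#|A| <= n)%N && (#|(h @: A)%SET| == #|A|)).

Lemma distinct_labelsP (E I : finType) (h : E -> I) n (A : {set E}) :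
  reflect ((#|A| <= n)%N /\ {in A &, injective h}) (A \in distinct_labels h n).
Proof.
rewrite finset.inE; apply: (iffP andP) => -[cA hA]; split=> //.
  exact/imset_injP.
exact/imset_injP.
Qed.

(** Exchange: [B] uses more labels than [A], so some element of [B] carries a
    label unused in [A], and adding it keeps the labels distinct. *)
Lemma matroid_distinct_labels (E I : finType) (h : E -> I) n :
  is_matroid (distinct_labels h n).
Proof.
split.
- by apply/distinct_labelsP; split=> [|x y]; rewrite ?cards0 ?finset.in_set0.
- move=> A B sAB /distinct_labelsP[cB hB]; apply/distinct_labelsP; split.
    exact: leq_trans (subset_leq_card sAB) cB.
  by move=> x y xA yA; apply: hB; exact: (fintype.subsetP sAB).
move=> A B /distinct_labelsP[cA hA] /distinct_labelsP[cB hB] ltAB.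
have /fintype.subsetPn[_ /imsetP[e eB ->] heA] :
    ~~ ((h @: B)%SET \subset (h @: A)%SET).
  apply: contraL ltAB => /subset_leq_card.
  by rewrite !card_in_imset // -leqNgt.
have eA : e \notin A by apply: contra heA => eA; exact: imset_f.
exists e; first by rewrite finset.in_setD eA.
apply/distinct_labelsP; split.
  by rewrite cardsU1 eA; exact: leq_trans ltAB cB.
have fresh x : x \in A -> h x != h e.
  by move=> xA; apply: contraNneq heA => <-; exact: imset_f.
move=> x y; rewrite !finset.in_setU1.
move=> /predU1P[->|xA] /predU1P[->|yA] // hxy; last exact: hA.
- by have := fresh _ yA; rewrite hxy eqxx.
- by have := fresh _ xA; rewrite hxy eqxx.
Qed.

(** * The maximum of a weight as a set function *)

Definition max_weight (R : realType) (E : finType) (g : E -> R) (A : {set E})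
    : R := \big[Num.max/0]_(e in A) g e.

Section MaxWeight.
Variables (R : realType) (E : finType) (g : E -> R).
Local Notation m := (max_weight g).

Lemma max_weight_ge0 A : 0 <= m A.
Proof. exact: bigmax_ge_id. Qed.

Lemma max_weight_mono : monotone_setfun m.
Proof.
by move=> A B sAB; apply: sub_bigmax => e; exact: (fintype.subsetP sAB).
Qed.

(** A heaviest element of [A :|: B] lies in [A] or in [B]; the other of the two
    sets still dominates [A :&: B]. *)
Lemma max_weight_submod : submodular m.
Proof.
move=> A B.
have le_U : m (A :|: B)%SET <= Num.max (m A) (m B).
  apply/bigmax_leP; split; first by rewrite le_max max_weight_ge0.
  move=> e; rewrite finset.in_setU le_max => /orP[] eAB.
    by rewrite le_bigmax_cond.
  by rewrite orbC le_bigmax_cond.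
have le_I : m (A :&: B)%SET <= Num.min (m A) (m B).
  by rewrite le_min !max_weight_mono ?finset.subsetIl ?finset.subsetIr.
by rewrite -(addr_max_min (m A)) lerD.
Qed.

End MaxWeight.

(** * Revenue at a fixed realization *)

Section Realization.
Variables (R : realType) (I : finType) (M : I -> {fset R}).
Hypothesis M_ge0 : forall (i : I) (r : R), r \in M i -> 0 <= r.
Implicit Types (e : call M) (pi : plan M) (v : I -> R) (S : {set call M}).

Definition payoff v e : R := if accepted v e then price e else 0.

Lemma price_ge0 e : 0 <= price e.
Proof. exact: M_ge0 (fsvalP (tagged e)). Qed.

Lemma payoff_ge0 v e : 0 <= payoff v e.
Proof. by rewrite /payoff; case: ifP => // _; exact: price_ge0. Qed.

Lemma payoff_le_price v e : payoff v e <= price e.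
Proof. by rewrite /payoff; case: ifP => // _; exact: price_ge0. Qed.

Lemma rev_at0 pi v : rev_at 0 pi v = 0.
Proof. by rewrite /rev_at big_pred0. Qed.

Lemma rev_at_nil n v : rev_at n ([::] : plan M) v = 0.
Proof. by rewrite /rev_at big_ord0. Qed.

Lemma rev_at_cons n e pi v :
  rev_at n.+1 (e :: pi) v = if accepted v e then price e else rev_at n pi v.
Proof.
rewrite /rev_at /= big_mkcond big_ord_recl /= (tnth_nth e) /=.
rewrite [X in _ * X]big_pred0 // mulr1.
under eq_bigr => t _.
  rewrite [X in _ * X]big_mkcond big_ord_recl /= !(tnth_nth e) /=.
  over.
case: ifP => acc /=.
  by rewrite mulr1 big1 ?addr0 // => t _; rewrite mul0r mulr0 if_same.
rewrite mulr0 add0r [RHS]big_mkcond; apply: eq_bigr => t _.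
rewrite mul1r !(tnth_nth e) [X in _ = if _ then _ * X else _]big_mkcond /=.
rewrite /bump /= !add1n ltnS; case: ifP => // _.
by congr (_ * _); apply: eq_bigr => s _; rewrite !(tnth_nth e) /bump /= !add1n.
Qed.

Lemma rev_at_ge0 n pi v : 0 <= rev_at n pi v.
Proof.
elim: pi n => [|e pi IH] [|n]; rewrite ?rev_at0 ?rev_at_nil // rev_at_cons.
by case: ifP => // _; exact: price_ge0.
Qed.

Lemma rev_at_le n pi v (c : R) : 0 <= c ->
  {in take n pi, forall e, payoff v e <= c} -> rev_at n pi v <= c.
Proof.
move=> c0; elim: pi n => [|e pi IH] [|n] le_c;
  rewrite ?rev_at0 ?rev_at_nil // rev_at_cons.
case: ifP => acc; last by apply: IH => x xpi; rewrite le_c // inE xpi orbT.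
by have := le_c e; rewrite inE eqxx /payoff acc; exact.
Qed.

Lemma rev_at_le_best n pi v :
  rev_at n pi v <= max_weight (payoff v) (attempted n pi).
Proof.
apply: rev_at_le => [|e epi]; first exact: max_weight_ge0.
by apply: le_bigmax_cond; rewrite finset.inE.
Qed.

Definition price_ge : rel (call M) := fun e1 e2 => price e2 <= price e1.

Lemma price_ge_trans : transitive price_ge.
Proof. by move=> e2 e1 e3 le21 le32; exact: le_trans le32 le21. Qed.

(** When the first call is accepted, its price dominates every later price;
    when it is rejected, its payoff is 0 and the rest of the plan decides. *)
Lemma sorted_rev_at_ge n pi v e :
  sorted price_ge pi -> (size pi <= n)%N -> e \in pi ->
  payoff v e <= rev_at n pi v.
Proof.
elim: pi n => [|e0 pi IH] [|n] //= pi_sorted; rewrite ltnS => le_n.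
rewrite rev_at_cons inE => /predU1P[->|epi].
  by rewrite /payoff; case: ifP => // _; exact: rev_at_ge0.
case: ifP => _; last exact: IH (path_sorted pi_sorted) _ _.
apply: le_trans (payoff_le_price v e) _.
by have /allP := order_path_min price_ge_trans pi_sorted; exact.
Qed.

Lemma sorted_rev_at n pi v :
  sorted price_ge pi -> (size pi <= n)%N ->
  rev_at n pi v = max_weight (payoff v) (attempted n pi).
Proof.
move=> pi_sorted le_n; apply/le_anti; rewrite rev_at_le_best /=.
apply/bigmax_leP; split=> [|e]; first exact: rev_at_ge0.
by rewrite finset.inE take_oversize //; exact: sorted_rev_at_ge.
Qed.

(** * Plans and independent sets *)

(** In a feasible plan the position of a call is determined by its agent, and
    hence so is the call. *)
Lemma attempted_indep n pi :
  feasible pi -> attempted n pi \in distinct_labels (@agent R I M) n.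
Proof.
rewrite /feasible => pi_feas.
have attE : attempted n pi =i take n pi by move=> e; rewrite finset.inE.
apply/distinct_labelsP; split.
  rewrite (eq_card attE); apply: leq_trans (card_size _) _.
  by rewrite size_take_min geq_minl.
move=> e1 e2; rewrite !attE => /mem_take e1pi /mem_take e2pi eq12.
have agent_nth (x : call M) : x \in pi ->
    nth (agent e1) (map (@agent R I M) pi) (index x pi) = agent x.
  by move=> xpi; rewrite (nth_map e1) ?index_mem // nth_index.
have : index e1 pi = index e2 pi.
  apply/eqP; rewrite -(nth_uniq (agent e1) _ _ pi_feas) ?size_map ?index_mem //.
  by rewrite !agent_nth // eq12.
by move=> /(congr1 (nth e1 pi)); rewrite !nth_index.
Qed.

Definition sorted_plan S : plan M := sort price_ge (fintype.enum S).

Lemma sorted_plan_sorted S : sorted price_ge (sorted_plan S).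
Proof. by apply: sort_sorted => e1 e2; exact: le_total. Qed.

Lemma size_sorted_plan S : size (sorted_plan S) = #|S|.
Proof. by rewrite size_sort cardE. Qed.

Lemma attempted_sorted_plan n S :
  (#|S| <= n)%N -> attempted n (sorted_plan S) = S.
Proof.
move=> le_n; apply/finset.setP => e.
by rewrite finset.inE take_oversize ?size_sorted_plan //= mem_sort mem_enum.
Qed.

Lemma feasible_sorted_plan S :
  {in S &, injective (@agent R I M)} -> feasible (sorted_plan S).
Proof.
move=> injS; rewrite /feasible map_inj_in_uniq.
  by rewrite sort_uniq enum_uniq.
by move=> e1 e2; rewrite !mem_sort !mem_enum; exact: injS.
Qed.

End Realization.

(** * Expectations *)

Section Expectation.
Variables (R : realType) (I : finType) (M : I -> {fset R}).
Hypothesis M_ge0 : forall (i : I) (r : R), r \in M i -> 0 <= r.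
Variables (d : measure_display) (T : measurableType d) (P : probability T R).
Variable (V : I -> {RV P >-> R}).
Implicit Types (e : call M) (pi : plan M) (S : {set call M}).

Local Notation val w := (fun i : I => V i w).

Lemma measurable_accepted e : measurable_fun setT (fun w => accepted (val w) e).
Proof. exact: measurable_realfun.measurable_fun_ler. Qed.

Lemma measurable_rev_at n pi :
  measurable_fun setT (fun w => rev_at n pi (val w)).
Proof.
elim: pi n => [|e pi IH] [|n].
- by under eq_fun do rewrite rev_at0; exact: measurable_cst.
- by under eq_fun do rewrite rev_at_nil; exact: measurable_cst.
- by under eq_fun do rewrite rev_at0; exact: measurable_cst.
under eq_fun do rewrite rev_at_cons.
by apply: measurable_fun_ifT => //; exact: measurable_accepted.
Qed.

Definition best_payoff S (w : T) : R := max_weight (payoff (val w)) S.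

Lemma measurable_best_payoff S : measurable_fun setT (best_payoff S).
Proof.
rewrite /best_payoff /max_weight.
elim: (index_enum _) => [|e s IH].
  by under eq_fun do rewrite big_nil; exact: measurable_cst.
under eq_fun do rewrite big_cons.
case: (e \in S) => //; apply: measurable_realfun.measurable_maxr => //.
by apply: measurable_fun_ifT => //; exact: measurable_accepted.
Qed.

(** There are finitely many calls, so the largest price bounds all payoffs. *)
Lemma best_payoff_Lfun S : best_payoff S \in Lfun P 1.
Proof.
apply/Lfun1_integrable; apply: measurable_bounded_integrable => //.
- exact: le_lt_trans (probability_le1 P measurableT) (ltry 1).
- exact: measurable_best_payoff.
exists (\big[Num.max/0]_(e : call M) price e); split; first exact: num_real.
move=> c lt_c w _ /=; apply: le_trans (ltW lt_c).
rewrite ger0_norm; last exact: max_weight_ge0.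
apply/bigmax_leP; split=> [|e _]; first exact: bigmax_ge_id.
exact: le_trans (payoff_le_price M_ge0 (val w) e) (le_bigmax _ _ e).
Qed.

Definition expected_best S : R := fine 'E_P[best_payoff S].

Lemma expected_bestE S : (expected_best S)%:E = ('E_P[best_payoff S])%E.
Proof. by rewrite fineK // expectation_fin_num // best_payoff_Lfun. Qed.

Lemma expected_best_mono : monotone_setfun expected_best.
Proof.
move=> A B sAB; rewrite -lee_fin !expected_bestE.
apply: expectation_le.
- exact: measurable_best_payoff.
- exact: measurable_best_payoff.
- by move=> w; exact: max_weight_ge0.
- by move=> w; exact: max_weight_ge0.
by apply: aeW => w; exact: max_weight_mono.
Qed.

Lemma expected_best_submod : submodular expected_best.
Proof.
move=> A B; rewrite -lee_fin !EFinD !expected_bestE.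
rewrite -!expectationD ?best_payoff_Lfun //.
apply: expectation_le.
- by apply: measurable_realfun.measurable_funD; exact: measurable_best_payoff.
- by apply: measurable_realfun.measurable_funD; exact: measurable_best_payoff.
- by move=> w /=; apply: addr_ge0; exact: max_weight_ge0.
- by move=> w /=; apply: addr_ge0; exact: max_weight_ge0.
by apply: aeW => w; exact: max_weight_submod.
Qed.

Lemma expected_rev_le_best n pi :
  (expected_rev V n pi <= (expected_best (attempted n pi))%:E)%E.
Proof.
rewrite expected_bestE; apply: expectation_le.
- exact: measurable_rev_at.
- exact: measurable_best_payoff.
- by move=> w; exact: rev_at_ge0.
- by move=> w; exact: max_weight_ge0.
by apply: aeW => w; exact: rev_at_le_best.
Qed.

Lemma expected_rev_sorted_plan n S : (#|S| <= n)%N ->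
  expected_rev V n (sorted_plan S) = (expected_best S)%:E.
Proof.
move=> le_n; rewrite expected_bestE; congr ('E_P[_])%E; apply/funext => w.
rewrite sorted_rev_at ?size_sorted_plan ?attempted_sorted_plan //.
exact: sorted_plan_sorted.
Qed.

End Expectation.

Lemma exists_optimal_set (R : realType) (E : finType) (indep : {set {set E}})
    (f : {set E} -> R) (A0 : {set E}) :
  A0 \in indep -> exists A, optimal_set indep f A.
Proof.
move=> A0_indep.
have [A A_indep A_max] :=
  @Order.TotalTheory.arg_maxP _ _ _ A0 [in indep] f A0_indep.
by exists A.
Qed.

Theorem theorem1 (R : realType) (I : finType) (M : I -> {fset R})
    (hM : forall (i : I) (r : R), r \in M i -> 0 <= r)
    (d : measure_display) (T : measurableType d) (P : probability T R)
    (V : I -> {RV P >-> R}) (hV : forall (i : I) (w : T), 0 <= V i w)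
    (n : nat) :
  exists (indep : {set {set call M}}) (f : {set call M} -> R),
    [/\ is_matroid indep, monotone_setfun f, submodular f &
        formulated_as V n indep f].
Proof.
pose indep := distinct_labels (@agent R I M) n.
pose f := expected_best (M := M) V.
have matroid : is_matroid indep by exact: matroid_distinct_labels.
have realize S : S \in indep -> exists pi,
    [/\ feasible pi, (size pi <= n)%N, attempted n pi = S &
        expected_rev V n pi = (f S)%:E].
  move=> /distinct_labelsP[le_n injS]; exists (sorted_plan S); split.
  - exact: feasible_sorted_plan.
  - by rewrite size_sorted_plan.
  - exact: attempted_sorted_plan.
  - exact: expected_rev_sorted_plan.
exists indep, f; split=> //.
- exact: expected_best_mono.
- exact: expected_best_submod.
split=> // [pi pi_feas|].
  by split; [exact: attempted_indep | exact: expected_rev_le_best].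
have [S [S_indep S_max]] : exists S, optimal_set indep f S.
  by case: matroid => indep0 _ _; exact: exists_optimal_set indep0.
have [pi [pi_feas _ piS pi_rev]] := realize S S_indep.
exists pi, S; split=> //; split=> // pi' pi'_feas; rewrite pi_rev.
apply: le_trans (expected_rev_le_best hM V n pi') _.
by rewrite lee_fin S_max // attempted_indep.
Qed.
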